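(* Let $A_1,A_2\in\mathbb{R}^{2\times2}$ and let $P_0,P_1,P_2$ be totally-real planes in $\mathbb{C}^2$ given by $$P_0=\mathbb{R}^2,\qquad P_j=(A_j+i\mathbb{I})\mathbb{R}^2,\quad j=1,2.$$ Assume that the pairwise unions of $P_0,P_1,P_2$ are locally polynomially convex at $0\in\mathbb{C}^2$. Assume further that (i) $|\det A_j|\le1$ and $\det A_j<0$ for $j=1,2$; (ii) $\det[A_1,A_2]>0$. Then $P_0\cup P_1\cup P_2$ is locally polynomially convex at the origin.
   Context: $\mathbb{I}$ is the $2\times2$ identity matrix and $[A_1,A_2]=A_1A_2-A_2A_1$. A plane is a 2-dimensional real subspace $P$ of $\mathbb{C}^2$; it is totally real if $P\cap iP=\{0\}$. For a compact set $K\subset\mathbb{C}^n$, the polynomially convex hull is $\widehat{K}=\{z\in\mathbb{C}^n: |p(z)|\le\sup_K|p| \text{ for all } p\in\mathbb{C}[z_1,\dots,z_n]\}$; $K$ is polynomially convex if $\widehat{K}=K$. A closed set $E\subset\mathbb{C}^n$ is locally polynomially convex at $p\in E$ if $E\cap\overline{B(p;r)}$ is polynomially convex for some $r>0$, where $B(p;r)$ is the open ball with centre $p$ and radius $r$. *)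

(* Defs.v *)
From HB Require Import structures.
From mathcomp Require Import all_boot all_order all_algebra.
From mathcomp Require Import complex.
From mathcomp Require Import all_classical all_reals all_analysis.
(* Not imported: the notations of mpoly clash with those of analysis
   ([Import -(notations) mpoly] gives access to its theory). *)
From mathcomp Require mpoly.

Set Implicit Arguments.
Unset Strict Implicit.
Unset Printing Implicit Defensive.

Import Order.TTheory GRing.Theory Num.Theory.
Import numFieldNormedType.Exports.

Local Open Scope classical_set_scope.
Local Open Scope ring_scope.

(* C^n is 'cV[R[i]^o]_n: the alias R[i]^o (regular algebra) is what carries
   the topology of R[i] as a numFieldType, hence the product topology on
   column vectors. *)

Section PolynomialConvexity.
Variables (R : realType) (n : nat).
Local Notation Cn := 'cV[R[i]^o]_n.

(* [Normc.normc] is the R-valued modulus ([`|_|] on R[i] is R[i]-valued). *)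
Definition euclidean_norm (z : Cn) : R :=
  Num.sqrt (\sum_(j < n) Normc.normc (z j 0) ^+ 2).

Definition euclidean_ball (p : Cn) (r : R) : set Cn :=
  [set z | euclidean_norm (z - p) < r].

Definition poly_eval (q : mpoly.mpoly n R[i]) (z : Cn) : R[i] :=
  mpoly.meval (fun j => z j 0) q.

Definition polynomial_hull (K : set Cn) : set Cn :=
  [set z | forall q : mpoly.mpoly n R[i],
     Normc.normc (poly_eval q z)
       <= sup [set Normc.normc (poly_eval q w) | w in K]].

(* The notion is only defined for compact sets; [sup] would be a junk value
   on unbounded ones. *)
Definition polynomially_convex (K : set Cn) : Prop :=
  compact K /\ polynomial_hull K = K.

Definition locally_polynomially_convex (E : set Cn) (p : Cn) : Prop :=
  [/\ closed E, E p & exists2 r : R, 0 < r &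
      polynomially_convex (E `&` closure (euclidean_ball p r))].

End PolynomialConvexity.

Section Planes.
Variable R : realType.
Local Notation C2 := 'cV[R[i]^o]_2.
Local Notation toC := (real_complex R).

Definition real_plane (P : set C2) : Prop :=
  exists u v : C2,
    (forall a b : R, toC a *: u + toC b *: v = 0 -> a = 0 /\ b = 0) /\
    P = [set z | exists a b : R, z = toC a *: u + toC b *: v].

Definition totally_real_plane (P : set C2) : Prop :=
  real_plane P /\ P `&` [set 'i%C *: z | z in P] = [set 0].

Definition R2 : set C2 := [set map_mx toC x | x in [set: 'cV[R]_2]].

Definition plane_of (A : 'M[R]_2) : set C2 :=
  [set (map_mx toC A + 'i%C *: 1%:M) *m z | z in R2].

End Planes.

Arguments R2 R : clear implicits.

(* Main.v *)
(** Two real matrices with [\det [A1, A2] > 0] are simultaneously symmetrizable: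
    there is a real positive definite [G] such that [G A1] and [G A2] are
    symmetric.  Put [p z = z^T G z].  On [P0] the values of [p] are nonnegative
    reals, while Cayley-Hamilton gives, for [z = (A_j + i) x] in [P_j],
    [Re (p z) = \tr A_j / 2 * Im (p z) - (\det A_j + 1) * x^T G x], so that
    [\det A_j >= -1] keeps [p (P1 `|` P2)] out of a sector around the positive
    axis.  Then one argues as in Kallin's lemma: a point [z] of the hull of the
    truncated union lies in the hull of the part in [P0] or of the part in
    [P1 `|` P2], both of which are polynomially convex.

    The one-variable functions needed to separate [p (P0)] from
    [p (P1 `|` P2)] are obtained without Runge's theorem.  Pole pushing
    approximates [1 / (p - b)] by polynomials for [b] in the gap between the two
    sets; rational Newton approximations with poles in the gap then give
    [sqrt (- p / e)] for [e] in the gap, and the product of two such roots, one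
    for each side of the positive axis, is proportional to [p] on [P0] and to
    [- p] on [P1 `|` P2].  The case [p z = 0] uses the functions
    [t / (t - p / e)] with [t] tending to [0]. *)

Require Import Defs.
From HB Require Import structures.
From mathcomp Require Import all_boot all_order all_algebra.
From mathcomp Require Import complex.
From mathcomp Require Import all_classical all_reals all_analysis.
From mathcomp Require Import ring lra.
From mathcomp Require mpoly.
Import -(notations) mpoly.

Set Implicit Arguments.
Unset Strict Implicit.
Unset Printing Implicit Defensive.

Import Order.TTheory GRing.Theory Num.Theory.
Import numFieldNormedType.Exports.

Local Open Scope classical_set_scope.
Local Open Scope ring_scope.
Local Open Scope complex_scope.

Local Notation mdl := Normc.normc.

(** * The modulus *)

Section Modulus.
Variable R : realType.
Implicit Types (x y : R[i]) (a b : R).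

Lemma mdl_ge0 x : 0 <= mdl x.
Proof. by case: x => a b; rewrite sqrtr_ge0. Qed.

Lemma mdlD x y : mdl (x + y) <= mdl x + mdl y.
Proof. by have := le_normcD x y. Qed.

Lemma mdlN x : mdl (- x) = mdl x.
Proof. exact: (normcN x). Qed.

Lemma mdlB x y : mdl (x - y) <= mdl x + mdl y.
Proof. by rewrite -(mdlN y) mdlD. Qed.

Lemma mdlX x n : mdl (x ^+ n) = mdl x ^+ n.
Proof.
elim: n => [|n IH]; first by rewrite !expr0 Normc.normc1.
by rewrite !exprS Normc.normcM IH.
Qed.

Lemma mdl_gt0 x : (0 < mdl x) = (x != 0).
Proof.
rewrite lt_def mdl_ge0 andbT; congr (~~ _); apply/eqP/eqP => [|->].
  exact: Normc.eq0_normc.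
exact: Normc.normc0.
Qed.

Lemma mdl_real a : mdl a%:C = `|a|.
Proof. by rewrite /= expr0n /= addr0 sqrtr_sqr. Qed.

Lemma mdl_sqr x : mdl x ^+ 2 = complex.Re x ^+ 2 + complex.Im x ^+ 2.
Proof. by case: x => a b; rewrite sqr_sqrtr // addr_ge0 // sqr_ge0. Qed.

Lemma Re_le_mdl x : `|complex.Re x| <= mdl x.
Proof.
rewrite -(@ler_pXn2r _ 2) ?nnegrE ?mdl_ge0 // mdl_sqr real_normK ?num_real //.
by rewrite lerDl sqr_ge0.
Qed.

Lemma Im_le_mdl x : `|complex.Im x| <= mdl x.
Proof.
rewrite -(@ler_pXn2r _ 2) ?nnegrE ?mdl_ge0 // mdl_sqr real_normK ?num_real //.
by rewrite lerDr sqr_ge0.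
Qed.

Lemma Re_sqrtc_ge0 x : 0 <= complex.Re (sqrtc x).
Proof. by case: x => a b; rewrite sqrtr_ge0. Qed.

(* For a square root [v] in the right half plane, [v^2 + |v|^2 = 2 (Re v) v],
   so the distance from [v^2] to [-|v|^2] controls the argument of [v]. *)
Lemma Re_sqrtc_ge (k : R) x :
  (forall t, 0 <= t -> k * t <= mdl (x + t%:C)) ->
  k * mdl (sqrtc x) <= 2 * complex.Re (sqrtc x).
Proof.
set v := sqrtc x => h.
have [->|v0] := eqVneq v 0; first by rewrite Normc.normc0 /= !mulr0.
have := h (mdl v ^+ 2) (sqr_ge0 _).
have -> : x + (mdl v ^+ 2)%:C = v * (2 * complex.Re v)%:C.
  rewrite -[x]sqr_sqrtc -/v mdl_sqr; case: (v) => a b /=.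
  by apply/eqP; rewrite eq_complex /=; apply/andP; split; apply/eqP; ring.
rewrite Normc.normcM mdl_real ger0_norm ?mulr_ge0 ?Re_sqrtc_ge0 //.
by rewrite expr2 mulrA [_ * mdl v]mulrC ler_pM2l // mdl_gt0.
Qed.

Lemma bernoulli a n : 0 <= a -> 1 + n%:R * a <= (1 + a) ^+ n.
Proof.
move=> a0; elim: n => [|n IH]; first by rewrite mul0r addr0 expr0.
rewrite exprS; apply: (@le_trans _ _ ((1 + a) * (1 + n%:R * a))); last first.
  by rewrite ler_pM2l // ltr_wpDr.
rewrite -natr1; have : 0 <= n%:R * a * a by rewrite !mulr_ge0 // ler0n.
lra.
Qed.

Lemma archi a : exists n : nat, a <= n%:R.
Proof.
exists (Num.bound `|a|); apply: (le_trans (ler_norm a)).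
by apply/ltW/archi_boundP/normr_ge0.
Qed.

(** For [0 < b < a], the powers of [a / b] grow at least linearly by Bernoulli and exceed [c]. This
    removes multiplicative constants from hull estimates. *)
Lemma le_of_pow_le a b c :
  0 <= b -> (forall n, a ^+ n <= c * b ^+ n) -> a <= b.
Proof.
rewrite le_eqVlt => /orP[/eqP <-|b0] h.
  by have := h 1%N; rewrite !expr1 mulr0.
rewrite leNgt; apply/negP => ba.
have d0 : 0 < a / b - 1 by rewrite subr_gt0 ltr_pdivlMr // mul1r.
have [n hn] := archi (c / (a / b - 1)).
have := bernoulli n (ltW d0).
have -> : 1 + (a / b - 1) = a / b by ring.
rewrite expr_div_n => h1; have := h n.
rewrite -ler_pdivrMr ?exprn_gt0 // => h2.
have : c <= n%:R * (a / b - 1) by rewrite -ler_pdivrMr.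
lra.
Qed.

End Modulus.

(** * Even and odd parts of powers of [1 + v] *)

(* [(half_powers n).1] and [(half_powers n).2] collect the even and the odd
   part of [(1 + v)^n], as polynomials in [v^2]. *)
Definition half_powers (R : realType) (n : nat) : {poly R[i]} * {poly R[i]} :=
  iter n (fun q => (q.1 + 'X * q.2, q.1 + q.2)) (1, 0).

Lemma half_powersE (R : realType) n (v : R[i]) :
  (1 + v) ^+ n = (half_powers R n).1.[v ^+ 2] + v * (half_powers R n).2.[v ^+ 2].
Proof.
elim: n => [|n IH]; first by rewrite /= hornerC horner0 mulr0 addr0 expr0.
by rewrite exprS IH /= !hornerE; ring.
Qed.

Lemma half_powersNE (R : realType) n (v : R[i]) :
  (1 - v) ^+ n = (half_powers R n).1.[v ^+ 2] - v * (half_powers R n).2.[v ^+ 2].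
Proof. by have := half_powersE n (- v); rewrite sqrrN mulNr. Qed.

Lemma half_powers0 (R : realType) n :
  (half_powers R n).1.[0] = 1 /\ (half_powers R n).2.[0] = n%:R.
Proof.
elim: n => [|n [h1 h2]]; first by rewrite /= !hornerE.
by rewrite /= !hornerD hornerM hornerX h1 h2 mul0r addr0 nat1r.
Qed.

Lemma mdl_one_addsub (R : realType) (v : R[i]) :
  mdl (1 + v) ^+ 2 = mdl (1 - v) ^+ 2 + 4 * complex.Re v.
Proof. by rewrite !mdl_sqr; case: v => a b /=; ring. Qed.

(** At a root [u = v^2] of the odd part, [(1 + v)^n = (1 - v)^n], so [|1 + v| = |1 - v|] and [v] is
    purely imaginary. The value [n] at [0] excludes [u = 0]. *)
Lemma half_powers_root (R : realType) n (u : R[i]) : (0 < n)%N ->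
  (half_powers R n).2.[u] = 0 -> exists2 t : R, 0 < t & u = - t%:C.
Proof.
move=> n0 Du; have u0 : u != 0.
  apply: contraTneq n0 => u0; move: Du; rewrite u0 (half_powers0 R n).2 => /eqP.
  by rewrite pnatr_eq0 => /eqP->.
pose v := sqrtc u; have vu : v ^+ 2 = u by exact: sqr_sqrtc.
have : mdl (1 + v) = mdl (1 - v).
  have : mdl (1 + v) ^+ n = mdl (1 - v) ^+ n.
    by rewrite -!mdlX half_powersE half_powersNE vu Du mulr0 addr0 subr0.
  by move=> /eqP; rewrite eqrXn2 ?mdl_ge0 // => /eqP.
have := mdl_one_addsub v => /[swap] -> h.
have re0 : complex.Re v = 0 by lra.
have uE : u = - (complex.Im v ^+ 2)%:C.
  rewrite -vu; move: re0; case: (v) => a b /= ->.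
  by apply/eqP; rewrite eq_complex /=; apply/andP; split; apply/eqP; ring.
exists (complex.Im v ^+ 2) => //.
rewrite lt_def sqr_ge0 andbT; apply: contraNneq u0 => h0.
by rewrite uE h0 oppr0.
Qed.

(** Bernoulli for [(1 + a / P)^n] bounds the gap below by [n * a * P^(n-1)]; multiplying by [P <= c]
    covers small [P] as well. *)
Lemma pow_gap (R : realType) (P a c : R) n : 0 <= P -> 0 <= a -> P <= c ->
  0 < c -> n%:R * a * P ^+ n <= c * ((P + a) ^+ n - P ^+ n).
Proof.
rewrite le_eqVlt => /orP[/eqP <-|P0] a0 Pc c0.
  rewrite expr0n add0r; case: n => [|n] /=.
    by rewrite expr0 subrr !mul0r mulr0.
  by rewrite subr0 mulr0 mulr_ge0 // ?exprn_ge0 // ltW.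
have := bernoulli n (divr_ge0 a0 (ltW P0)).
have -> : 1 + a / P = (P + a) / P by field; rewrite gt_eqF.
rewrite expr_div_n ler_pdivlMr ?exprn_gt0 // => h.
have h1 : n%:R * (a / P) * P ^+ n <= (P + a) ^+ n - P ^+ n.
  by rewrite lerBrDl; apply: le_trans h; rewrite mulrDl mul1r.
apply: le_trans (_ : P * ((P + a) ^+ n - P ^+ n) <= _).
  have -> : n%:R * a * P ^+ n = P * (n%:R * (a / P) * P ^+ n).
    by field; rewrite gt_eqF.
  by rewrite ler_pM2l.
apply: ler_wpM2r => //; rewrite subr_ge0; have P1 := ltW P0.
by rewrite lerXn2r ?nnegrE ?addr_ge0 // lerDl.
Qed.

(** * Square roots near a sector *)

(** The point subtracted from [w] lies on a ray in the gap between the positive axis and the region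
    of the second alternative. On the axis the imaginary parts already differ by [t]; in the region,
    a distance [d] gives [t * (c + 1) - d <= c * (t + d)]. *)
Lemma sector_gap_dist (R : realType) (c s : R) (w : R[i]) (t : R) :
  0 <= c -> s = 1 \/ s = -1 ->
  complex.Im w = 0 /\ 0 <= complex.Re w \/ complex.Re w <= c * `|complex.Im w| ->
  0 <= t -> t / (c + 1) <= mdl (w - t%:C * ((c + 1) +i* s)).
Proof.
move=> c0 hs hw t0; have c1 : 0 < c + 1 by rewrite ltr_wpDl.
rewrite ler_pdivrMr //.
have := Re_le_mdl (w - t%:C * ((c + 1) +i* s)).
have := Im_le_mdl (w - t%:C * ((c + 1) +i* s)).
have := mdl_ge0 (w - t%:C * ((c + 1) +i* s)).
move: (mdl _) => d; case: w hw => a b /= hw; rewrite !mul0r ?subr0 ?addr0.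
rewrite !ler_norml => d0 /andP[h1 h2] /andP[h3 h4].
have cd : 0 <= c * d by rewrite mulr_ge0.
have h1' : 0 <= c * (b - t * s + d) by rewrite mulr_ge0 //; lra.
have h2' : 0 <= c * (d - (b - t * s)) by rewrite mulr_ge0 //; lra.
case: hw => [[b0 a0]|hw]; first by case: hs => hs; subst s; lra.
case: (lerP 0 b) hw => hb; [rewrite ger0_norm // | rewrite ltr0_norm //].
  by move=> hw; case: hs => hs; subst s; lra.
by move=> hw; case: hs => hs; subst s; lra.
Qed.

Lemma conj_sqrt_prod (R : realType) (E : R) (e w v1 v2 : R[i]) :
  e * e^* = (E ^+ 2)%:C -> e != 0 -> v1 ^+ 2 = - e^-1 * w ->
  v2 ^+ 2 = - (e^*)^-1 * w -> E%:C * (v1 * v2) = w \/ E%:C * (v1 * v2) = - w.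
Proof.
move=> hE e0 h1 h2; have e0' : e^* != 0 by rewrite conjc_eq0.
have /eqP : (E%:C * (v1 * v2)) ^+ 2 = w ^+ 2.
  rewrite !exprMn h1 h2 -rmorphXn /= -hE; field.
  by rewrite e0 e0'.
by rewrite eqf_sqr => /orP[] /eqP ->; [left|right].
Qed.

(** Dividing the wrong sign by [v2] gives [E v1 = - e^* v2] or [E v1 = e^* v2], hence the sign of
    [Re (e^* v2)]. The first forces [Re w > (c + 1) |Im w|]; the second cannot occur for [w] on the
    nonnegative axis. *)
Lemma conj_sqrt_prod_sector (R : realType) (c E : R) (w v1 v2 : R[i]) :
  let e := (c + 1) +i* 1 in
  0 <= c -> 0 < E -> v2 ^+ 2 = - (e^*)^-1 * w ->
  0 < complex.Re v1 -> 0 < complex.Re v2 ->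
  (complex.Re w <= c * `|complex.Im w| -> E%:C * (v1 * v2) <> w) /\
  (complex.Im w = 0 /\ 0 <= complex.Re w -> E%:C * (v1 * v2) <> - w).
Proof.
move=> e c0 E0 h2 r1 r2.
have e0 : e^* != 0.
  by rewrite conjc_eq0; apply/eqP => -[_ /eqP]; rewrite oner_eq0.
have wE : w = - (e^* * v2 ^+ 2) by rewrite h2; field; rewrite e0.
have v20 : v2 != 0 by apply/eqP => v20; move: r2; rewrite v20 ltxx.
have c1 : 0 < c + 1 by rewrite ltr_wpDl.
have [wR wI] :
    complex.Re w = - ((c + 1) * (complex.Re v2 ^+ 2 - complex.Im v2 ^+ 2) +
                      2 * complex.Re v2 * complex.Im v2) /\
    complex.Im w = complex.Re v2 ^+ 2 - complex.Im v2 ^+ 2 -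
                   2 * (c + 1) * complex.Re v2 * complex.Im v2.
  by rewrite wE; case: (v2) => a b /=; split; ring.
have evR : complex.Re (e^* * v2) = (c + 1) * complex.Re v2 + complex.Im v2.
  by case: (v2) => a b /=; ring.
have ER u : complex.Re (E%:C * u) = E * complex.Re u.
  by case: u => a b /=; ring.
have e1 : 1 <= c + 1 by lra.
have Er1 := mulr_gt0 E0 r1.
set a := complex.Re v2 in r2 wR wI evR; set b := complex.Im v2 in wR wI evR.
split=> [hw hv|[hI hR] hv].
  have : E%:C * v1 = - (e^* * v2).
    by apply: (mulIf v20); rewrite -mulrA hv {1}wE; ring.
  move=> /(congr1 (@complex.Re R)); rewrite ER raddfN /= evR => hab.
  have hb : 0 < - ((c + 1) * a + b) by lra.
  have hb1 : 0 < - b by have := mulr_gt0 c1 r2; lra.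
  have h1 : 0 < complex.Re w - (c + 1) * complex.Im w.
    have -> : complex.Re w - (c + 1) * complex.Im w =
      2 * ((c + 1) * - b + a) * - ((c + 1) * a + b) by rewrite wR wI; ring.
    by apply: mulr_gt0 hb; rewrite mulr_gt0 // addr_gt0 // mulr_gt0.
  have h2' : 0 < complex.Re w + (c + 1) * complex.Im w.
    have -> : complex.Re w + (c + 1) * complex.Im w =
      2 * a * - b * (1 + (c + 1) ^+ 2) by rewrite wR wI; ring.
    by rewrite mulr_gt0 // ?mulr_gt0 // ltr_pwDl // sqr_ge0.
  case: (lerP 0 (complex.Im w)) hw => hI.
    by rewrite ger0_norm //; lra.
  by rewrite ltr0_norm //; lra.
have : E%:C * v1 = e^* * v2.
  by apply: (mulIf v20); rewrite -mulrA hv {1}wE; ring.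
move=> /(congr1 (@complex.Re R)); rewrite ER evR => hab.
rewrite hI in wI; rewrite wR in hR.
(* Since [Im w = 0], the left side is [- Re w]. Hence [b <= 0], and then [(c + 1) a + b > 0]
   contradicts [a^2 - b^2 = 2 (c + 1) a b]. *)
have h0 : 2 * (a * b * ((c + 1) ^+ 2 + 1)) <= 0.
  have -> : 2 * (a * b * ((c + 1) ^+ 2 + 1)) = - - ((c + 1) * (a ^+ 2 - b ^+ 2) +
    2 * a * b) + (c + 1) * - (a ^+ 2 - b ^+ 2 - 2 * (c + 1) * a * b) by ring.
  by rewrite -wI oppr0 mulr0 addr0 oppr_le0.
have b0 : b <= 0.
  move: h0; rewrite pmulr_rle0 // pmulr_lle0; first by rewrite pmulr_rle0.
  by rewrite ltr_wpDl // sqr_ge0.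
have : 0 < a ^+ 2 + b ^+ 2 by rewrite ltr_pwDl ?sqr_ge0 // exprn_gt0.
have : 0 <= - b * ((c + 1) * a + b) by rewrite mulr_ge0 //; lra.
lra.
Qed.

(** * Polynomial approximation on a set and a point of its hull *)

Section Approximation.
Variables (R : realType) (T : Type) (Pol : (T -> R[i]) -> Prop).
Variables (X : set T) (z : T).
Hypothesis PolC : forall c, Pol (fun=> c).
Hypothesis PolD : forall f g, Pol f -> Pol g -> Pol (fun x => f x + g x).
Hypothesis PolM : forall f g, Pol f -> Pol g -> Pol (fun x => f x * g x).
Hypothesis Pol_bounded :
  forall q, Pol q -> exists B : R, forall x, X x -> mdl (q x) <= B.
Hypothesis hull : forall q (B : R),
  Pol q -> (forall x, X x -> mdl (q x) <= B) -> mdl (q z) <= B.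

Let X' : set T := X `|` [set z].

(** Uniform approximation includes the point [z], so that estimates at [z] survive in the limit;
    [Pol] stands for an algebra of functions and [hull] puts [z] in the hull of [X]. *)
Definition approx (g : T -> R[i]) := forall e : R, 0 < e ->
  exists q, Pol q /\ forall x, X' x -> mdl (g x - q x) <= e.

Lemma approx_Pol q : Pol q -> approx q.
Proof.
move=> Pq e e0; exists q; split => // x _.
by rewrite subrr Normc.normc0 ltW.
Qed.

Lemma approx_cst c : approx (fun=> c).
Proof. exact/approx_Pol/PolC. Qed.

Lemma approx_ext f g : (forall x, X' x -> f x = g x) -> approx f -> approx g.
Proof.
move=> fg af e /af[q [Pq qe]]; exists q; split => // x Xx.
by rewrite -fg // qe.
Qed.

Lemma approx_le g B :
  approx g -> (forall x, X x -> mdl (g x) <= B) -> mdl (g z) <= B.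
Proof.
move=> ag gB; rewrite leNgt; apply/negP => Bg.
pose e := (mdl (g z) - B) / 3.
have e0 : 0 < e by rewrite divr_gt0 // subr_gt0.
have [q [Pq qe]] := ag _ e0.
have : mdl (q z) <= B + e.
  apply: hull => // x Xx.
  have -> : q x = g x - (g x - q x) by ring.
  by apply: (le_trans (mdlB _ _)); apply: lerD; [exact: gB | apply: qe; left].
have : mdl (g z) <= mdl (q z) + e.
  have -> : g z = q z + (g z - q z) by ring.
  by apply: (le_trans (mdlD _ _)); rewrite lerD2l; apply: qe; right.
rewrite /e in e0 *; lra.
Qed.

Lemma approx_bounded g :
  approx g -> exists2 B, 0 < B & forall x, X' x -> mdl (g x) <= B.
Proof.
move=> /(_ _ ltr01)[q [Pq q1]]; have [B hB] := Pol_bounded Pq.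
have B0 : 0 <= Num.max B 0 by rewrite le_max lexx orbT.
exists (Num.max B 0 + 1); first by rewrite ltr_wpDl.
have qB : forall x, X' x -> mdl (q x) <= Num.max B 0.
  move=> x [Xx|->]; first by rewrite le_max hB.
  by apply: hull => // y Xy; rewrite le_max hB.
move=> x Xx; have -> : g x = q x + (g x - q x) by ring.
by apply: (le_trans (mdlD _ _)); rewrite lerD // ?qB // q1.
Qed.

Lemma approxD f g : approx f -> approx g -> approx (fun x => f x + g x).
Proof.
move=> af ag e e0; have e2 : 0 < e / 2 by rewrite divr_gt0.
have [p [Pp pe]] := af _ e2; have [q [Pq qe]] := ag _ e2.
exists (fun x => p x + q x); split; first exact: PolD.
move=> x Xx; have -> : f x + g x - (p x + q x) = (f x - p x) + (g x - q x) by ring.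
apply: (le_trans (mdlD _ _)); have := pe _ Xx; have := qe _ Xx; lra.
Qed.

Lemma approxM f g : approx f -> approx g -> approx (fun x => f x * g x).
Proof.
move=> af ag e e0.
have [F F0 hF] := approx_bounded af; have [G G0 hG] := approx_bounded ag.
pose d := Num.min 1 (e / (F + G + 1)).
have S0 : 0 < F + G + 1 by lra.
have d0 : 0 < d by rewrite lt_min ltr01 divr_gt0.
have [p [Pp pe]] := af _ d0; have [q [Pq qe]] := ag _ d0.
exists (fun x => p x * q x); split; first exact: PolM.
move=> x Xx.
have -> : f x * g x - p x * q x =
  f x * (g x - q x) + (f x - p x) * (g x - (g x - q x)) by ring.
apply: (le_trans (mdlD _ _)); rewrite !Normc.normcM.
have d1 : d <= 1 by rewrite ge_min lexx.
have q1 : mdl (g x - (g x - q x)) <= G + 1.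
  apply: (le_trans (mdlB _ _)); apply: lerD; first exact: hG.
  by apply: le_trans (qe _ Xx) d1.
apply: (@le_trans _ _ (F * d + d * (G + 1))).
  by apply: lerD; apply: ler_pM; rewrite ?mdl_ge0 ?hF ?qe ?pe.
have -> : F * d + d * (G + 1) = d * (F + G + 1) by ring.
by rewrite -ler_pdivlMr // ge_min lexx orbT.
Qed.

Lemma approxZ c f : approx f -> approx (fun x => c * f x).
Proof. by apply: approxM; exact: approx_cst. Qed.

Lemma approxX n f : approx f -> approx (fun x => f x ^+ n).
Proof.
move=> af; elim: n => [|n IH].
  by apply: approx_ext (approx_cst 1) => x _; rewrite expr0.
by apply: approx_ext (approxM af IH) => x _; rewrite exprS.
Qed.

Lemma approx_horner (P : {poly R[i]}) f : approx f -> approx (fun x => P.[f x]).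
Proof.
move=> af; elim/poly_ind: P => [|P c IH].
  by apply: approx_ext (approx_cst 0) => x _; rewrite horner0.
apply: approx_ext (approxD (approxM IH af) (approx_cst c)) => x _.
by rewrite !hornerE.
Qed.

Lemma approx_lim g :
  (forall e : R, 0 < e -> exists f, approx f /\
    forall x, X' x -> mdl (g x - f x) <= e) -> approx g.
Proof.
move=> h e e0; have e2 : 0 < e / 2 by rewrite divr_gt0.
have [f [af fe]] := h _ e2; have [q [Pq qe]] := af _ e2.
exists q; split => // x Xx; have -> : g x - q x = (g x - f x) + (f x - q x) by ring.
apply: (le_trans (mdlD _ _)); have := fe _ Xx; have := qe _ Xx; lra.
Qed.

(** * Inverses and square roots as uniform limits of polynomials *)

Lemma onesub_neq0 (c : R[i]) : mdl c <= 2^-1 -> 1 - c != 0.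
Proof.
move=> c1; rewrite subr_eq0; apply/eqP => c2.
by move: c1; rewrite -c2 Normc.normc1; lra.
Qed.

(** The partial sums of the geometric series are iterates of [s -> 1 + g * s], and each step
    multiplies the error by [g]. The bound on [g] passes from [X] to [z] by the hull property. *)
Lemma approx_geometric g : approx g -> (forall x, X x -> mdl (g x) <= 2^-1) ->
  approx (fun x => (1 - g x)^-1).
Proof.
move=> ag gX.
have g2 x : X' x -> mdl (g x) <= 2^-1.
  by move=> [/gX//|->]; exact: approx_le.
have [C C0 hC] : exists2 C : R, 0 < C & forall x, X' x -> mdl (1 - g x)^-1 <= C.
  exists 2 => // x /g2 gx.
  rewrite Normc.normcV -[2]invrK lef_pV2 ?posrE ?invr_gt0 //; last first.
    by rewrite mdl_gt0 onesub_neq0.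
  have := mdlD (1 - g x) (g x).
  rewrite subrK Normc.normc1; lra.
have S n : exists s, approx s /\
    forall x, X' x -> mdl ((1 - g x)^-1 - s x) <= C * 2^-1 ^+ n.
  elim: n => [|n [s [as_ hs]]].
    exists (fun=> 0); split; first exact: approx_cst.
    by move=> x Xx; rewrite subr0 expr0 mulr1 hC.
  exists (fun x => 1 + g x * s x); split.
    by apply: approxD (approx_cst _) (approxM ag as_).
  move=> x Xx.
  have -> : (1 - g x)^-1 - (1 + g x * s x) = g x * ((1 - g x)^-1 - s x).
    have := onesub_neq0 (g2 _ Xx).
    move: (1 - g x) (subKr 1 (g x)) => w <- w0; field.
    exact: w0.
  rewrite Normc.normcM exprS mulrCA.
  by apply: ler_pM; rewrite ?mdl_ge0 ?g2 ?hs.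
apply: approx_lim => e e0.
have [n hn] := archi (C / e).
have [s [as_ hs]] := S n.
exists s; split => // x Xx; apply: (le_trans (hs _ Xx)).
rewrite exprVn ler_pdivrMr ?exprn_gt0 // mulrC -ler_pdivrMr //.
apply: (le_trans hn); rewrite -natrX ler_nat ltnW //.
exact: ltn_expl.
Qed.

(* Pole pushing: the pole [-t] is moved inwards along the negative axis,
   starting from far away, by steps small compared to its distance [k t1]
   to the values of [f]. *)
Lemma approx_resolvent f (k : R) : approx f -> 0 < k ->
  (forall x t, X x -> 0 <= t -> k * t <= mdl (f x + t%:C)) ->
  forall t, 0 < t -> (forall x, X' x -> f x + t%:C != 0) /\
    approx (fun x => (f x + t%:C)^-1).
Proof.
move=> af k0 fk t1 t10.
have [B B0 hB] := approx_bounded af.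
have d0 : 0 < k * t1 / 2 by rewrite divr_gt0 // mulr_gt0.
(* Induction on the number of steps of length [k * t1 / 2]. In the base case [2 * B <= t] the pole
   is so far out that a single geometric series converges. *)
have key (n : nat) t : t1 <= t -> 2 * B - n%:R * (k * t1 / 2) <= t ->
    (forall x, X' x -> f x + t%:C != 0) /\ approx (fun x => (f x + t%:C)^-1).
  elim: n t => [|n IH] t t1t.
    rewrite mul0r subr0 => Bt.
    have t0 : 0 < t by apply: lt_le_trans t1t.
    have tC : t%:C != 0 by rewrite -mdl_gt0 mdl_real gtr0_norm.
    pose g x := - (t%:C^-1) * f x.
    have ag : approx g by apply: approxZ.
    have fE x : f x + t%:C = t%:C * (1 - g x) by rewrite /g; field.
    have g2 x : X' x -> mdl (g x) <= 2^-1.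
      move=> Xx; rewrite Normc.normcM mdlN Normc.normcV mdl_real gtr0_norm //.
      by rewrite mulrC ler_pdivrMr //; have := hB _ Xx; lra.
    split=> [x Xx|]; first by rewrite fE mulf_neq0 // onesub_neq0 // g2.
    have := approx_geometric ag (fun x Xx => g2 x (or_introl Xx)).
    move=> /(approxZ t%:C^-1); apply: approx_ext => x Xx.
    by rewrite fE invfM.
  rewrite -(natr1 n) => tB.
  have t1s : t1 <= t + k * t1 / 2 by lra.
  have [||f0 ai] := IH (t + k * t1 / 2) => //.
    by move: tB; rewrite mulrDl mul1r; lra.
  (* The old resolvent times the step length: [f + t] is the old denominator times [1 - g], and
     [|g| <= 1/2] on [X] because [f] stays at distance [k * t1] from the old pole. *)
  pose g x := (k * t1 / 2)%:C * (f x + (t + k * t1 / 2)%:C)^-1.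
  have ag : approx g by apply: approxZ.
  have fE x : X' x -> f x + t%:C = (f x + (t + k * t1 / 2)%:C) * (1 - g x).
    by move=> /f0 h; rewrite /g mulrBr mulrCA divff // !mulr1 rmorphD /=; ring.
  have gX x : X x -> mdl (g x) <= 2^-1.
    move=> Xx; rewrite Normc.normcM Normc.normcV mdl_real gtr0_norm //.
    rewrite ler_pdivrMr ?mdl_gt0 ?f0 //; last by left.
    have := fk x (t + k * t1 / 2) Xx.
    have : k * t1 <= k * (t + k * t1 / 2) by rewrite ler_pM2l.
    by move=> h1 h2; have := le_trans h1 (h2 (le_trans (ltW t10) t1s)); lra.
  have g2 x : X' x -> mdl (g x) <= 2^-1.
    by move=> [/gX//|->]; exact: approx_le.
  split=> [x Xx|]; first by rewrite fE // mulf_neq0 ?f0 // onesub_neq0 // g2.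
  have := approxM ai (approx_geometric ag gX).
  by apply: approx_ext => x Xx; rewrite fE // invfM.
have [n hn] := archi (2 * B / (k * t1 / 2)).
apply: (key n) => //; apply: (@le_trans _ _ 0); last exact: ltW.
by rewrite subr_le0 -ler_pdivrMr.
Qed.

Lemma approx_inv_prod f (k : R) (rs : seq R[i]) : approx f -> 0 < k ->
  (forall x t, X x -> 0 <= t -> k * t <= mdl (f x + t%:C)) ->
  (forall r, r \in rs -> exists2 t : R, 0 < t & r = - t%:C) ->
  approx (fun x => (\prod_(r <- rs) ('X - r%:P)).[f x]^-1).
Proof.
move=> af k0 fk; elim: rs => [|r rs IH] hrs.
  by apply: approx_ext (approx_cst 1) => x _; rewrite big_nil hornerE invr1.
have [t t0 rt] := hrs r (mem_head _ _).
have [_ ai] := approx_resolvent af k0 fk t0.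
have {}IH : approx (fun x => (\prod_(r <- rs) ('X - r%:P)).[f x]^-1).
  by apply: IH => s srs; apply: hrs; rewrite inE srs orbT.
apply: approx_ext (approxM ai IH) => x _.
by rewrite big_cons hornerM invfM hornerXsubC rt opprK.
Qed.

(* [v (1 + r^m) / (1 - r^m)] with [r = (1 - v) / (1 + v)] (Newton's
   approximations of [v] when [m] is a power of two) is a rational function
   of [v^2] with poles on the negative axis. *)
Lemma approx_sqrtc f (k : R) : approx f -> 0 < k ->
  (forall x t, X x -> 0 <= t -> k * t <= mdl (f x + t%:C)) ->
  approx (fun x => sqrtc (f x)).
Proof.
move=> af k0 fk.
(* Bounding the resolvent at [z] by the hull property carries the separation from the negative axis
   over to [z]. *)
have fk' x t : X' x -> 0 <= t -> k * t <= mdl (f x + t%:C).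
  move=> [Xx|->] t0; first exact: fk.
  move: t0; rewrite le_eqVlt => /orP[/eqP <-|t0]; first by rewrite mulr0 mdl_ge0.
  have [f0 ai] := approx_resolvent af k0 fk t0.
  have := approx_le (B := (k * t)^-1) ai.
  rewrite Normc.normcV lef_pV2 ?posrE ?mulr_gt0 ?mdl_gt0 ?f0 //; last by right.
  apply=> x0 Xx; rewrite Normc.normcV lef_pV2 ?posrE ?mulr_gt0 ?mdl_gt0 ?f0 //.
    by apply: fk => //; exact: ltW.
  by left.
pose v x := sqrtc (f x).
have vf x : v x ^+ 2 = f x by exact: sqr_sqrtc.
have vk x : X' x -> k * mdl (v x) <= 2 * complex.Re (v x).
  by move=> Xx; apply: Re_sqrtc_ge => t; exact: fk'.
have [B B0 hB] := approx_bounded af.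
apply: approx_lim => e e0.
(* A bound for [|1 - v|^2]: from [|v|^2 = |f| <= B] follows [|v| <= 1 + B]. *)
pose c := (1 + (1 + B)) ^+ 2.
have c0 : 0 < c by rewrite exprn_gt0 // addr_gt0 // addr_gt0.
have [n1 hn1] := archi e^-1; have [n2 hn2] := archi (c / (k * e)).
(* [n1] handles the zeros of [f], where the error is [1 / m], and [n2] all other points. The even
   exponent [m] turns moduli into the squared moduli compared by [mdl_one_addsub]. *)
pose n := (n1 + n2).+1.
have n0 : 0 < n%:R :> R by rewrite ltr0n.
have hn1' : e^-1 <= n%:R.
  by apply: (le_trans hn1); rewrite ler_nat /n -addnS leq_addr.
have hn2' : c / (k * e) <= n%:R.
  by apply: (le_trans hn2); rewrite ler_nat /n -addSn leq_addl.
pose m := (2 * n)%N; have m0 : (0 < m)%N by [].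
pose N := (half_powers R m).1; pose D := (half_powers R m).2.
have D0 : D != 0.
  apply/eqP => h; have := (half_powers0 R m).2; rewrite -/D h horner0 => /esym/eqP.
  by rewrite pnatr_eq0.
have Dx x : X' x -> D.[f x] != 0.
  move=> Xx; apply/eqP => /(half_powers_root m0)[t t0 ft].
  have := fk' x t Xx (ltW t0); rewrite ft addrC subrr Normc.normc0.
  by rewrite leNgt mulr_gt0.
have aD : approx (fun x => D.[f x]^-1).
  have [rs Drs] := closed_field_poly_normal D.
  have : approx (fun x => (\prod_(r <- rs) ('X - r%:P)).[f x]^-1).
    apply: approx_inv_prod (fk) _ => // r rrs.
    apply: (half_powers_root m0); apply/eqP; rewrite -/(root _ _) -/D Drs.
    by rewrite rootZ ?lead_coef_eq0 // root_prod_XsubC.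
  move=> /(approxZ (lead_coef D)^-1); apply: approx_ext => x _.
  by rewrite [in RHS]Drs hornerZ invfM.
exists (fun x => N.[f x] * D.[f x]^-1); split.
  by apply: approxM aD; exact: approx_horner.
move=> x Xx; rewrite -/(v x) -[v x](mulfK (Dx _ Xx)) -mulrBl.
(* The error is [|1 - v|^m / |D|]; it remains to bound [D] from below. *)
have NE : (1 - v x) ^+ m = - (v x * D.[f x] - N.[f x]).
  by rewrite half_powersNE vf opprB.
rewrite Normc.normcM -mdlN -NE Normc.normcV ler_pdivrMr ?mdl_gt0 ?Dx //.
have [v0|v0] := eqVneq (v x) 0.
  have fx : f x = 0 by rewrite -vf v0 expr0n.
  rewrite v0 subr0 expr1n Normc.normc1 fx /D (half_powers0 R m).2.
  have -> : (m%:R : R[i]) = (m%:R : R)%:C by rewrite rmorph_nat.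
  rewrite mdl_real ger0_norm ?ler0n // mulrC -ler_pdivrMr // mul1r.
  by apply: (le_trans hn1'); rewrite ler_nat leq_pmull.
have s0 : 0 < mdl (v x) by rewrite mdl_gt0.
have DE : (1 + v x) ^+ m - (1 - v x) ^+ m = 2 * v x * D.[f x].
  by rewrite half_powersE half_powersNE vf -/N -/D; ring.
rewrite -(ler_pM2l s0) mulrCA.
have : mdl (1 + v x) ^+ m - mdl (1 - v x) ^+ m <= 2 * (mdl (v x) * mdl D.[f x]).
  rewrite -!mdlX lerBlDr.
  have -> : (1 + v x) ^+ m = 2 * v x * D.[f x] + (1 - v x) ^+ m by rewrite -DE subrK.
  apply: (le_trans (mdlD _ _)); rewrite lerD2r !Normc.normcM mulrA.
  have -> : (2 : R[i]) = (2 : R)%:C by rewrite rmorph_nat.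
  by rewrite mdl_real ger0_norm.
rewrite mdlX /m !exprM mdl_one_addsub.
set P := mdl (1 - v x) ^+ 2.
have P0 : 0 <= P by rewrite sqr_ge0.
have a0 : 0 <= 4 * complex.Re (v x) by rewrite mulr_ge0 // Re_sqrtc_ge0.
have Pc : P <= c.
  have B1 := ltW B0; rewrite lerXn2r ?nnegrE ?mdl_ge0 ?addr_ge0 //.
  apply: (le_trans (mdlB _ _)); rewrite Normc.normc1 lerD2l.
  have := hB _ Xx; rewrite -vf mdlX => h.
  case: (leP (mdl (v x)) 1) => h1; first by rewrite (le_trans h1) // lerDl ltW.
  rewrite (@le_trans _ _ (mdl (v x) ^+ 2)) //; last by rewrite ler_wpDl.
  by rewrite expr2 ler_peMr ?mdl_ge0 // ltW.
have := pow_gap n P0 a0 Pc c0.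
set Q := (P + _) ^+ n; set Pn := P ^+ n => h1 h2.
have Pn0 : 0 <= Pn by rewrite exprn_ge0.
(* Since [Re v >= k |v| / 2], the gap between the powers grows like [n |v|]. The factor [|v|]
   therefore cancels and the error is uniform near the zeros of [f]. *)
have h3 : n%:R * (2 * (k * mdl (v x))) * Pn <= c * (Q - Pn).
  apply: le_trans h1; apply: ler_wpM2r => //; apply: ler_wpM2l; first exact: ltW.
  by have := vk _ Xx; lra.
have h4 : c <= n%:R * (k * e) by rewrite -ler_pdivrMr // mulr_gt0.
have h5 : c * (2 * (mdl (v x) * Pn)) <= e * (n%:R * (2 * (k * mdl (v x))) * Pn).
  have -> : e * (n%:R * (2 * (k * mdl (v x))) * Pn) =
    n%:R * (k * e) * (2 * (mdl (v x) * Pn)) by ring.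
  by apply: ler_wpM2r => //; rewrite !mulr_ge0 // mdl_ge0.
have h6 : c * (2 * (mdl (v x) * Pn)) <= c * (e * (Q - Pn)).
  by apply: (le_trans h5); rewrite [c * (e * _)]mulrCA ler_pM2l.
rewrite ler_pM2l // in h6.
have h7 : e * (Q - Pn) <= e * (2 * (mdl (v x) * mdl D.[f x])) by rewrite ler_pM2l.
have := le_trans h6 h7; lra.
Qed.

(** * Separating two sets by a polynomial, after Kallin *)

Section Kallin.
Variables (p : T -> R[i]) (c : R) (K1 K2 : set T).
Hypotheses (Pp : Pol p) (c0 : 0 <= c).
Hypothesis X12 : forall x, X x -> K1 x \/ K2 x.
Hypothesis K1X : K1 `<=` X.
Hypothesis K2X : K2 `<=` X.
Hypothesis pK1 : forall x, K1 x -> complex.Im (p x) = 0 /\ 0 <= complex.Re (p x).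
Hypothesis pK2 : forall x, K2 x -> complex.Re (p x) <= c * `|complex.Im (p x)|.

(** For [s = 1] and [s = -1], the directions of two rays in the gap, one on each side of the
    positive axis; [E] is their modulus and [k] the separation constant after division by [e s]. *)
Let e (s : R) : R[i] := (c + 1) +i* s.
Let E : R := Num.sqrt ((c + 1) ^+ 2 + 1).
Let k : R := (c + 1)^-1 / E.

Let E2 : E ^+ 2 = (c + 1) ^+ 2 + 1.
Proof. by rewrite sqr_sqrtr // addr_ge0 // sqr_ge0. Qed.

Let E0 : 0 < E.
Proof. by rewrite sqrtr_gt0 ltr_wpDl // sqr_ge0. Qed.

Let k0 : 0 < k.
Proof. by rewrite divr_gt0 // invr_gt0 ltr_wpDl. Qed.

Let mdl_e s : s = 1 \/ s = -1 -> mdl (e s) = E.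
Proof. by move=> hs; rewrite /= /E; case: hs => ->; rewrite ?sqrrN expr1n. Qed.

Let gap_resolvent s x t : s = 1 \/ s = -1 -> X x -> 0 <= t ->
  k * t <= mdl (- (e s)^-1 * p x + t%:C).
Proof.
move=> hs Xx t0.
have e0 : e s != 0 by rewrite -mdl_gt0 mdl_e.
have -> : - (e s)^-1 * p x + t%:C = - (e s)^-1 * (p x - t%:C * e s) by field.
rewrite Normc.normcM mdlN Normc.normcV mdl_e //.
rewrite /k [_ * t]mulrAC mulrC ler_pM2l ?invr_gt0 // mulrC.
apply: sector_gap_dist => //.
by case: (X12 Xx) => [/pK1|/pK2]; [left|right].
Qed.

Let approx_ep s : approx (fun x => - (e s)^-1 * p x).
Proof. exact/approxZ/approx_Pol. Qed.

(* The geometric mean of the two branches [sqrtc (- p / e)] and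
   [sqrtc (- p / e^* )], cut along rays on either side of the positive axis,
   is [p] on the positive axis and [- p] on the other side of the cuts. *)
Lemma approx_split : exists h, [/\ approx h,
  forall x, K1 x -> h x = p x, forall x, K2 x -> h x = 0 &
  h z = p z \/ h z = 0].
Proof.
have h1 : (1 : R) = 1 \/ (1 : R) = -1 by left.
have hN1 : (-1 : R) = 1 \/ (-1 : R) = -1 by right.
pose v s x := sqrtc (- (e s)^-1 * p x).
have av s : s = 1 \/ s = -1 -> approx (v s).
  by move=> hs; apply: (approx_sqrtc (approx_ep s) k0) => x t; exact: gap_resolvent.
have vE s x : v s x ^+ 2 = - (e s)^-1 * p x by exact: sqr_sqrtc.
have ec : e (-1) = (e 1)^* by [].
have e0 : e 1 != 0 by rewrite -mdl_gt0 mdl_e.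
have eJ : e 1 * (e 1)^* = (E ^+ 2)%:C.
  by rewrite E2; apply/eqP; rewrite eq_complex /=; apply/andP; split; apply/eqP; ring.
have dich x : E%:C * (v 1 x * v (-1) x) = p x \/ E%:C * (v 1 x * v (-1) x) = - p x.
  exact: (conj_sqrt_prod eJ e0 (vE 1 x) (vE (-1) x)).
have vpos s x : s = 1 \/ s = -1 -> X x -> p x != 0 -> 0 < complex.Re (v s x).
  move=> hs Xx px; have := Re_sqrtc_ge (fun t => @gap_resolvent s x t hs Xx).
  rewrite -/(v s x) => h; have : 0 < k * mdl (v s x).
    rewrite mulr_gt0 // mdl_gt0 sqrtc_eq0 mulf_neq0 // oppr_eq0 invr_eq0.
    by rewrite -mdl_gt0 mdl_e.
  lra.
have sec x : X x -> p x != 0 ->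
    (complex.Re (p x) <= c * `|complex.Im (p x)| ->
      E%:C * (v 1 x * v (-1) x) <> p x) /\
    (complex.Im (p x) = 0 /\ 0 <= complex.Re (p x) ->
      E%:C * (v 1 x * v (-1) x) <> - p x).
  move=> Xx px; apply: conj_sqrt_prod_sector => //; try exact: vpos.
(* The product is [p] or [- p] everywhere, also at [z]; averaging it with [p] gives [p] or [0]. *)
exists (fun x => 2^-1 * (p x + E%:C * (v 1 x * v (-1) x))); split.
- apply: approxZ; apply: approxD; first exact: approx_Pol.
  by apply: approxZ; apply: approxM; exact: av.
- move=> x K1x; case: (dich x) => [->|h]; first by field.
  have [px|px] := eqVneq (p x) 0; first by rewrite h px; ring.
  by have [_ /(_ (pK1 K1x))] := sec x (K1X K1x) px.
- move=> x K2x; case: (dich x) => h; last by rewrite h subrr mulr0.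
  have [px|px] := eqVneq (p x) 0; first by rewrite h px; ring.
  by have [/(_ (pK2 K2x))] := sec x (K2X K2x) px.
- by case: (dich z) => ->; [left; field|right; ring].
Qed.

(** On [X], the function [q^n * h] vanishes off [K] and is at most [M * B^n] on [K]. The hull
    property bounds it at [z], and taking [n]-th roots removes [M] and [h z]. *)
Lemma hull_of_carrier (h : T -> R[i]) (K : set T) q (B : R) :
  approx h -> h z != 0 -> (forall x, X x -> K x \/ h x = 0) ->
  Pol q -> 0 <= B -> (forall x, K x -> mdl (q x) <= B) -> mdl (q z) <= B.
Proof.
move=> ah hz hK Pq B0 qB.
have [M M0 hM] := approx_bounded ah.
apply: (@le_of_pow_le _ _ _ (M / mdl (h z))) => // n.
rewrite mulrAC ler_pdivlMr ?mdl_gt0 // -mdlX -Normc.normcM.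
apply: (approx_le (g := fun x => q x ^+ n * h x)).
  by apply: approxM ah; exact/approxX/approx_Pol.
move=> x Xx; rewrite Normc.normcM mdlX mulrC; case: (hK x Xx) => [Kx|->].
  apply: ler_pM; rewrite ?mdl_ge0 ?exprn_ge0 ?mdl_ge0 //; first by apply: hM; left.
  by apply: lerXn2r; rewrite ?nnegrE ?mdl_ge0 ?qB.
by rewrite Normc.normc0 mul0r mulr_ge0 ?exprn_ge0 // ltW.
Qed.

(** The function [h] of [approx_split] vanishes on [K2], and [p - h] vanishes on [K1]. One of them
    equals [p z] at [z] and carries the estimate. *)
Lemma kallin_off : p z != 0 ->
  (forall q (B : R), Pol q -> 0 <= B -> (forall x, K1 x -> mdl (q x) <= B) ->
     mdl (q z) <= B) \/
  (forall q (B : R), Pol q -> 0 <= B -> (forall x, K2 x -> mdl (q x) <= B) ->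
     mdl (q z) <= B).
Proof.
move=> pz; have [h [ah h1 h2 [hz|hz]]] := approx_split; [left|right].
  move=> q B; apply: hull_of_carrier ah _ _; first by rewrite hz.
  by move=> x /X12[K1x|/h2]; [left|right].
have ag : approx (fun x => p x + - 1 * h x).
  by apply: approxD; [exact: approx_Pol|exact: approxZ].
move=> q B; apply: hull_of_carrier ag _ _; first by rewrite hz mulr0 addr0.
by move=> x /X12[/h1 ->|K2x]; [right; ring|left].
Qed.

(* [t / (t - p / e)] equals [1] where [p = 0] and, as [t] tends to [0], stays
   bounded on [X] and tends to [0] away from [p = 0]. *)
Lemma kallin_zero q (B d : R) : p z = 0 -> Pol q -> 0 <= B -> 0 < d ->
  (forall x, X x -> mdl (p x) <= d -> mdl (q x) <= B) -> mdl (q z) <= B.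
Proof.
move=> pz Pq B0 d0 qB.
have h1 : (1 : R) = 1 \/ (1 : R) = -1 by left.
apply: (@le_of_pow_le _ _ _ k^-1) => // n.
have [Q Q0 hQ] := approx_bounded (approxX n (approx_Pol Pq)).
rewrite leNgt; apply/negP => lt.
pose r := mdl (q z) ^+ n; have r0 : 0 < r.
  by apply: le_lt_trans lt; rewrite mulr_ge0 ?exprn_ge0 // invr_ge0 ltW.
pose d' := d / E; have d'0 : 0 < d' by rewrite divr_gt0.
(* The first bound keeps the denominator above [d' / 2] where [|p| > d]; the second makes the
   product with [q^n] at most [r / 2] there. *)
pose t := Num.min (d' / 2) (d' * r / (4 * Q)).
have t0 : 0 < t by rewrite lt_min !divr_gt0 // mulr_gt0.
have td : t <= d' / 2 by rewrite ge_min lexx.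
have tr : t * (4 * Q) <= d' * r.
  by rewrite -ler_pdivlMr ?mulr_gt0 // ge_min lexx orbT.
have [f0 ai] := approx_resolvent (approx_ep 1) k0
  (fun x t Xx t0 => @gap_resolvent 1 x t h1 Xx t0) t0.
pose B' := Num.max (k^-1 * B ^+ n) (r / 2).
have : r <= B'.
  have -> : r = mdl (q z ^+ n * (t%:C * (- (e 1)^-1 * p z + t%:C)^-1)).
    rewrite pz mulr0 add0r divff ?mulr1 ?mdlX //.
    by rewrite -mdl_gt0 mdl_real gtr0_norm.
  apply: (approx_le (g := fun x => q x ^+ n * (t%:C * (- (e 1)^-1 * p x + t%:C)^-1))).
    by apply: approxM; [exact/approxX/approx_Pol|exact: approxZ].
  move=> x Xx; rewrite Normc.normcM; rewrite !Normc.normcM Normc.normcV.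
  have F0 := f0 x (or_introl Xx).
  rewrite mdl_real gtr0_norm // -/(e 1).
  have hF := @gap_resolvent 1 x t h1 Xx (ltW t0).
  set F := mdl (_ + _) in hF *; have Fp : 0 < F by rewrite mdl_gt0.
  case: (lerP (mdl (p x)) d) => hd.
    rewrite le_max; apply/orP; left; rewrite mulrC; apply: ler_pM.
    - by rewrite divr_ge0 ?ltW.
    - exact: mdl_ge0.
    - by rewrite ler_pdivrMr // mulrC ler_pdivlMr // mulrC.
    - by rewrite mdlX lerXn2r ?nnegrE ?mdl_ge0 ?qB.
  rewrite le_max; apply/orP; right.
  have hF2 : d' / 2 <= F.
    have := mdlB (- (e 1)^-1 * p x + t%:C) t%:C; rewrite addrK -/F.
    rewrite Normc.normcM mdlN Normc.normcV mdl_e // mdl_real gtr0_norm //.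
    have : d' <= E^-1 * mdl (p x) by rewrite mulrC ler_pM2r ?invr_gt0 // ltW.
    by lra.
  rewrite mulrA ler_pdivrMr //.
  have : mdl (q x ^+ n) * t <= Q * t.
    by apply: ler_wpM2r; [exact: ltW|apply: hQ; left].
  have : r * (d' / 2) <= r * F by rewrite ler_pM2l.
  lra.
by rewrite le_max !leNgt lt /= ltr_pdivrMr // ltr_pMr // ltr1n.
Qed.

End Kallin.
End Approximation.

(** * Polynomial functions and balls *)

Section PolynomialFunctions.
Variables (R : realType) (n : nat).
Local Notation Cn := 'cV[R[i]^o]_n.

Definition polyfun (f : Cn -> R[i]) := exists q, forall z, f z = poly_eval q z.

Lemma polyfun_cst c : polyfun (fun=> c).
Proof. by exists (mpolyC n c) => z; rewrite /poly_eval mevalC. Qed.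

Lemma polyfun_coord j : polyfun (fun z => z j 0).
Proof. by exists (mpolyX _ (mnm1 j)) => z; rewrite /poly_eval mevalXU. Qed.

Lemma polyfunD f g : polyfun f -> polyfun g -> polyfun (fun z => f z + g z).
Proof.
by move=> [p hp] [q hq]; exists (p + q) => z; rewrite hp hq /poly_eval mevalD.
Qed.

Lemma polyfunM f g : polyfun f -> polyfun g -> polyfun (fun z => f z * g z).
Proof.
by move=> [p hp] [q hq]; exists (p * q) => z; rewrite hp hq /poly_eval mevalM.
Qed.

(** Boundedness is part of the condition so that products stay in the class; [d] bounds the
    coordinates, which suits monomials. *)
Definition lipschitz0 (r : R) (f : Cn -> R[i]) := exists C : R, 0 <= C /\
  forall (z : Cn) (d : R), 0 <= d -> d <= r -> (forall j, mdl (z j 0) <= d) ->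
    mdl (f z) <= C /\ mdl (f z - f 0) <= C * d.

Lemma lipschitz0_cst r c : lipschitz0 r (fun=> c).
Proof.
exists (mdl c); split=> [|z d d0 _ zd]; first exact: mdl_ge0.
by rewrite subrr Normc.normc0; split => //; rewrite mulr_ge0 ?mdl_ge0.
Qed.

Lemma lipschitz0D r f g :
  lipschitz0 r f -> lipschitz0 r g -> lipschitz0 r (fun z => f z + g z).
Proof.
move=> [C [C0 hC]] [D [D0 hD]]; exists (C + D); split; first exact: addr_ge0.
move=> z d d0 dr zd.
have [h1 h2] := hC z d d0 dr zd; have [h3 h4] := hD z d d0 dr zd.
split; first by apply: le_trans (mdlD _ _) (lerD h1 h3).
rewrite opprD addrACA mulrDl; exact: le_trans (mdlD _ _) (lerD h2 h4).
Qed.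

Lemma lipschitz0M r f g : 0 <= r ->
  lipschitz0 r f -> lipschitz0 r g -> lipschitz0 r (fun z => f z * g z).
Proof.
move=> r0 [C [C0 hC]] [D [D0 hD]]; exists (C * D *+ 2); split.
  by rewrite mulrn_wge0 // mulr_ge0.
have z0 : forall j : 'I_n, mdl ((0 : Cn) j 0) <= 0.
  by move=> j; rewrite mxE Normc.normc0.
have [g0 _] := hD 0 0 (lexx _) r0 z0.
move=> z d d0 dr zd.
have [h1 h2] := hC z d d0 dr zd; have [h3 h4] := hD z d d0 dr zd.
have CD : 0 <= C * D by rewrite mulr_ge0.
have h5 : mdl (f z * g z) <= C * D by rewrite Normc.normcM ler_pM ?mdl_ge0.
split; first by rewrite mulr2n ler_wpDr.
have -> : f z * g z - f 0 * g 0 = f z * (g z - g 0) + (f z - f 0) * g 0 by ring.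
apply: (le_trans (mdlD _ _)); rewrite !Normc.normcM.
have -> : C * D *+ 2 * d = C * (D * d) + C * d * D by ring.
by apply: lerD; apply: ler_pM; rewrite ?mdl_ge0.
Qed.

Lemma lipschitz0_coord r j : 0 <= r -> lipschitz0 r (fun z => z j 0).
Proof.
move=> r0; exists (1 + r); split=> [|z d d0 dr zd]; first by rewrite addr_ge0.
rewrite mxE subr0; have zj := zd j; split.
  by apply: (le_trans zj); rewrite ler_wpDl.
by apply: (le_trans zj); rewrite ler_peMl // lerDl.
Qed.

Lemma lipschitz0_poly_eval r q : 0 <= r -> lipschitz0 r (poly_eval q).
Proof.
move=> r0; have ext f g : lipschitz0 r f -> f =1 g -> lipschitz0 r g.
  by move=> [C [C0 hC]] /funext <-; exists C.
elim/mpolyind: q => [|c m p _ _ IH].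
  by apply: ext (lipschitz0_cst r 0) _ => z; rewrite /poly_eval meval0.
have hm : lipschitz0 r (fun z => \prod_(i < n) z i 0 ^+ m i).
  elim: (index_enum _) => [|i s IHs].
    by apply: ext (lipschitz0_cst r 1) _ => z; rewrite big_nil.
  have hi : lipschitz0 r (fun z => z i 0 ^+ m i).
    elim: (m i) => [|k IHk].
      by apply: ext (lipschitz0_cst r 1) _ => z; rewrite expr0.
    apply: ext (lipschitz0M r0 (lipschitz0_coord i r0) IHk) _ => z.
    by rewrite exprS.
  by apply: ext (lipschitz0M r0 hi IHs) _ => z; rewrite big_cons.
apply: ext (lipschitz0D (lipschitz0M r0 (lipschitz0_cst r c) hm) IH) _ => z.
by rewrite /poly_eval mevalD mevalZ mevalX.
Qed.

Lemma mdl_le_euclidean (z : Cn) j : mdl (z j 0) <= euclidean_norm z.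
Proof.
have h0 (k : 'I_n) : 0 <= mdl (z k 0) ^+ 2 by rewrite sqr_ge0.
rewrite -(@ler_pXn2r _ 2) ?nnegrE ?mdl_ge0 ?sqrtr_ge0 //.
rewrite sqr_sqrtr ?sumr_ge0 // (bigD1 j) //= lerDl sumr_ge0 //.
Qed.

Lemma euclidean_normZ c (z : Cn) : euclidean_norm (c *: z) = mdl c * euclidean_norm z.
Proof.
rewrite /euclidean_norm -[mdl c]ger0_norm ?mdl_ge0 // -sqrtr_sqr -sqrtrM ?sqr_ge0 //.
rewrite mulr_sumr; congr Num.sqrt; apply: eq_bigr => i _.
by rewrite mxE Normc.normcM exprMn.
Qed.

Lemma poly_eval_bounded q r :
  exists B : R, forall z : Cn, euclidean_norm z <= r -> mdl (poly_eval q z) <= B.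
Proof.
have r0 : 0 <= Num.max r 0 by rewrite le_max lexx orbT.
have [B [_ hB]] := lipschitz0_poly_eval q r0; exists B => z zr.
apply: (hB z _ r0 (lexx _) _).1 => j.
by rewrite le_max (le_trans (mdl_le_euclidean z j) zr).
Qed.

Lemma polynomial_hull_le (K : set Cn) r z f (B : R) : K !=set0 ->
  (forall x, K x -> euclidean_norm x <= r) -> polynomial_hull K z -> polyfun f ->
  (forall x, K x -> mdl (f x) <= B) -> mdl (f z) <= B.
Proof.
move=> [x Kx] Kr hz [q fq] fB; rewrite fq; apply: (le_trans (hz q)).
apply: ge_sup; first by exists (mdl (poly_eval q x)), x.
by move=> _ [y Ky <-]; rewrite -fq fB.
Qed.

(** Boundedness of [K] makes [sup] a true upper bound of the values, and nonemptiness makes it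
    nonnegative. *)
Lemma polynomial_hullP (K : set Cn) r z : K !=set0 ->
  (forall x, K x -> euclidean_norm x <= r) ->
  (forall f (B : R), polyfun f -> 0 <= B -> (forall x, K x -> mdl (f x) <= B) ->
     mdl (f z) <= B) -> polynomial_hull K z.
Proof.
move=> [x0 Kx0] Kr h q; have [B hB] := poly_eval_bounded q r.
have ub x : K x ->
    mdl (poly_eval q x) <= sup [set mdl (poly_eval q w) | w in K].
  move=> Kx; apply: ub_le_sup; last by exists x.
  by exists B => _ [w /Kr/hB ? <-].
apply: h; first by exists q.
- by apply: le_trans (ub _ Kx0); exact: mdl_ge0.
- exact: ub.
Qed.

End PolynomialFunctions.

Section Ball.
Variable R : realType.
Local Notation C2 := 'cV[R[i]^o]_2.

Lemma euclidean_norm2 (z : C2) :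
  euclidean_norm z = Num.sqrt (mdl (z 0 0) ^+ 2 + mdl (z 1 0) ^+ 2).
Proof.
rewrite /euclidean_norm !big_ord_recl big_ord0 addr0.
by congr (Num.sqrt (_ + mdl (z _ _) ^+ 2)); apply: val_inj.
Qed.

Lemma mx_ballP (x y : C2) (e : R) : 0 < e ->
  (forall j, mdl (x j 0 - y j 0) < e) -> ball x e%:C y.
Proof.
move=> e0 h; split; first by rewrite ltcR.
by move=> i j; rewrite ord1 /ball /= ltcR; exact: h.
Qed.

Lemma closure_euclidean_ball (r : R) : 0 < r ->
  closure (euclidean_ball (0 : C2) r) = [set z | euclidean_norm z <= r].
Proof.
move=> r0; apply/seteqP; split=> z /=.
  move=> cz; apply/ler_addgt0Pr => e e0; have e2 : 0 < e / 2 by rewrite divr_gt0.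
  have eC : 0 < (e / 2)%:C by rewrite ltcR.
  have [y [/= yr [_ hy]]] := cz _ (nbhsx_ballx z _ eC).
  have {}hy j : mdl (z j 0) <= mdl (y j 0) + e / 2.
    have := hy j 0; rewrite /ball /= ltcR => /ltW h.
    have := mdlD (z j 0 - y j 0) (y j 0); rewrite subrK.
    by move=> h'; apply: (le_trans h'); rewrite addrC lerD2l.
  rewrite /euclidean_ball /= subr0 in yr.
  apply: le_trans (_ : euclidean_norm y + e <= _); last first.
    by rewrite lerD2r ltW.
  have y0 := mdl_le_euclidean y 0; have y1 := mdl_le_euclidean y 1.
  have [hy0 hy1] := (hy 0, hy 1).
  rewrite -(@ler_pXn2r _ 2) ?nnegrE ?addr_ge0 ?sqrtr_ge0 ?(ltW e0) //.
  move: y0 y1; set s := euclidean_norm y => y0 y1.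
  have sE : s ^+ 2 = mdl (y 0 0) ^+ 2 + mdl (y 1 0) ^+ 2.
    by rewrite /s euclidean_norm2 sqr_sqrtr // addr_ge0 // sqr_ge0.
  rewrite euclidean_norm2 sqr_sqrtr ?addr_ge0 ?sqr_ge0 //.
  have q0 : mdl (z 0 0) ^+ 2 <= (mdl (y 0 0) + e / 2) ^+ 2.
    by apply: lerXn2r; rewrite ?nnegrE ?addr_ge0 ?mdl_ge0 ?(ltW e2).
  have q1 : mdl (z 1 0) ^+ 2 <= (mdl (y 1 0) + e / 2) ^+ 2.
    by apply: lerXn2r; rewrite ?nnegrE ?addr_ge0 ?mdl_ge0 ?(ltW e2).
  apply: (le_trans (lerD q0 q1)).
  have p0 : 0 <= e * (s - mdl (y 0 0)) by rewrite mulr_ge0 ?subr_ge0 ?(ltW e0).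
  have p1 : 0 <= e * (s - mdl (y 1 0)) by rewrite mulr_ge0 ?subr_ge0 ?(ltW e0).
  have : 0 <= e ^+ 2 by rewrite sqr_ge0.
  have : 0 <= e * s by rewrite mulr_ge0 ?sqrtr_ge0 ?(ltW e0).
  move: sE p0 p1; move: (mdl (y 0 0)) (mdl (y 1 0)) => a b sE p0 p1.
  have -> : (s + e) ^+ 2 = s ^+ 2 + 2 * (e * s) + e ^+ 2 by ring.
  have -> : (a + e / 2) ^+ 2 + (b + e / 2) ^+ 2 =
    a ^+ 2 + b ^+ 2 + e * a + e * b + e ^+ 2 / 2 by field.
  rewrite sE; lra.
move=> zr B /nbhs_ballP[d /= d0 dB].
have dE : d = (complex.Re d)%:C by rewrite RRe_real ?gtr0_real.
have e0 : 0 < complex.Re d by rewrite -ltcR -dE.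
move: (complex.Re d) dE e0 => e dE e0.
(* Scaling by [1 - s] enters the open ball and moves each coordinate by at most [s * r < e]. *)
pose s := e / (r + e) / 2.
have re0 : 0 < r + e by rewrite addr_gt0.
have s0 : 0 < s by rewrite !divr_gt0.
have s1 : s < 1.
  by rewrite /s ltr_pdivrMr // ltr_pdivrMr //; lra.
exists ((1 - s)%:C *: z); split.
  rewrite /euclidean_ball /= subr0 euclidean_normZ mdl_real ger0_norm; last by lra.
  apply: (@le_lt_trans _ _ ((1 - s) * r)); first by rewrite ler_wpM2l //; lra.
  by have := mulr_gt0 s0 r0; lra.
apply: dB; rewrite dE; apply: mx_ballP => // j.
rewrite mxE.
have -> : z j 0 - (1 - s)%:C * z j 0 = s%:C * z j 0.
  by rewrite rmorphB /=; ring.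
rewrite Normc.normcM mdl_real gtr0_norm //.
apply: (@le_lt_trans _ _ (s * r)).
  by rewrite ler_pM2l // (le_trans (mdl_le_euclidean z j)).
rewrite /s mulrAC ltr_pdivrMr // mulrAC ltr_pdivrMr //.
have := mulr_gt0 e0 e0; have := mulr_gt0 e0 r0; lra.
Qed.

End Ball.

(** * Symmetrization and the quadratic form *)

Lemma det2E (R : comNzRingType) (A : 'M[R]_2) :
  \det A = A 0 0 * A 1 1 - A 0 1 * A 1 0.
Proof.
rewrite (expand_det_row A 0) !big_ord_recl big_ord0 /cofactor !det_mx11 !mxE /=.
have -> : lift 0 0 = 1 :> 'I_2 by apply: val_inj.
have -> : lift 1 0 = 0 :> 'I_2 by apply: val_inj.
by rewrite expr0 addr0 !expr1; ring.
Qed.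

Lemma mulmx2E (R : comNzRingType) m (A : 'M[R]_2) (B : 'M[R]_(2, m)) i j :
  (A *m B) i j = A i 0 * B 0 j + A i 1 * B 1 j.
Proof.
rewrite mxE !big_ord_recl big_ord0 addr0.
by have -> : lift ord0 ord0 = 1 :> 'I_2 by apply: val_inj.
Qed.

Section QuadraticForm.
Variable R : realType.
Local Notation C2 := 'cV[R[i]^o]_2.

(* For [C = [A, B]], the form [J C] ([J] the symplectic matrix) is definite
   because [\det (J C) = \det C > 0], and it symmetrizes [A] and [B] because
   [\tr (A C) = \tr (B C) = 0]. *)
Lemma common_symmetrizer (A B : 'M[R]_2) : 0 < \det (A *m B - B *m A) ->
  exists g11 g12 g22 : R, [/\ 0 < g11, 0 < g11 * g22 - g12 ^+ 2,
    g11 * A 0 1 + g12 * A 1 1 = g12 * A 0 0 + g22 * A 1 0 &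
    g11 * B 0 1 + g12 * B 1 1 = g12 * B 0 0 + g22 * B 1 0].
Proof.
have cE i j : (A *m B - B *m A) i j =
    A i 0 * B 0 j + A i 1 * B 1 j - (B i 0 * A 0 j + B i 1 * A 1 j).
  by rewrite [LHS]mxE [X in _ + X]mxE !mulmx2E.
rewrite det2E !cE.
move: (A 0 0) (A 0 1) (A 1 0) (A 1 1) => a b c d.
move: (B 0 0) (B 0 1) (B 1 0) (B 1 1) => a' b' c' d' {cE}.
(* The commutator is the trace-zero matrix with rows [(p, q)] and [(r, -p)]; the symmetrizing form
   has entries [r], [-p], [-q], with a common sign fixed by that of [r]. *)
pose p := a * a' + b * c' - (a' * a + b' * c).
pose q := a * b' + b * d' - (a' * b + b' * d).
pose r := c * a' + d * c' - (c' * a + d' * c).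
set D := (X in 0 < X) => D0.
have DE : D = r * - q - p ^+ 2 by rewrite /D /p /q /r; ring.
have sA : r * b + - p * d = - p * a + - q * c by rewrite /p /q /r; ring.
have sB : r * b' + - p * d' = - p * a' + - q * c' by rewrite /p /q /r; ring.
have [r0|r0|r0] := ltgtP r 0.
- exists (- r), p, q; split; rewrite ?oppr_gt0 //; last by lra.
  + by move: D0; rewrite DE; lra.
  + by lra.
- exists r, (- p), (- q); split => //.
  by move: D0; rewrite DE sqrrN.
- by move: D0; rewrite DE r0 mul0r sub0r oppr_gt0 ltNge sqr_ge0.
Qed.

(** The complex bilinear, not Hermitian, extension of the real form, hence a polynomial in [z]. *)
Definition qform (g11 g12 g22 : R) (z : C2) : R[i] :=
  g11%:C * (z 0 0 * z 0 0) + (2 * g12)%:C * (z 0 0 * z 1 0)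
  + g22%:C * (z 1 0 * z 1 0).

Lemma polyfun_qform g11 g12 g22 : polyfun (qform g11 g12 g22).
Proof.
by do ![apply: polyfunD | apply: polyfunM]; exact: polyfun_cst || exact: polyfun_coord.
Qed.

Lemma plane_ofP (A : 'M[R]_2) (z : C2) : plane_of A z -> exists x y : R,
  z 0 0 = (A 0 0 * x + A 0 1 * y) +i* x /\ z 1 0 = (A 1 0 * x + A 1 1 * y) +i* y.
Proof.
move=> [_ [x _ <-] <-]; exists (x 0 0), (x 1 0).
rewrite !mulmx2E !mxE /=.
by split; apply/eqP; rewrite eq_complex /=; apply/andP; split; apply/eqP; ring.
Qed.

Lemma quadratic_form_ge (g11 g12 g22 x y : R) :
  g11 * (g11 * x ^+ 2 + 2 * g12 * x * y + g22 * y ^+ 2) >=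
  (g11 * g22 - g12 ^+ 2) * y ^+ 2.
Proof.
have -> : g11 * (g11 * x ^+ 2 + 2 * g12 * x * y + g22 * y ^+ 2) =
  (g11 * x + g12 * y) ^+ 2 + (g11 * g22 - g12 ^+ 2) * y ^+ 2 by ring.
by rewrite lerDr sqr_ge0.
Qed.

Lemma R2P (z : C2) : R2 R z <-> complex.Im (z 0 0) = 0 /\ complex.Im (z 1 0) = 0.
Proof.
split=> [[x _ <-]|[h0 h1]]; first by rewrite !mxE.
exists (\col_i complex.Re (z i 0)) => //; apply/matrixP => i j.
rewrite ord1 !mxE.
have : complex.Im (z i 0) = 0 by case: (i) => [[|[|m]] hm] //; 
 [rewrite -h0|rewrite -h1]; congr (complex.Im (z _ _)); apply: val_inj.
by case: (z i 0) => a b /= ->.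
Qed.

Lemma qform_plane (A : 'M[R]_2) g11 g12 g22 (z : C2) :
  0 < g11 -> 0 < g11 * g22 - g12 ^+ 2 ->
  g11 * A 0 1 + g12 * A 1 1 = g12 * A 0 0 + g22 * A 1 0 ->
  -1 <= \det A -> plane_of A z ->
  complex.Re (qform g11 g12 g22 z) <= \tr A / 2 * complex.Im (qform g11 g12 g22 z).
Proof.
move=> g0 dg sym dA /plane_ofP[x [y [h0 h1]]].
rewrite /qform h0 h1 /=.
have -> : \tr A = A 0 0 + A 1 1.
  rewrite /mxtrace !big_ord_recl big_ord0 addr0.
  by have -> : lift ord0 ord0 = 1 :> 'I_2 by apply: val_inj.
rewrite det2E in dA.
move: (A 0 0) (A 0 1) (A 1 0) (A 1 1) dA sym => a b c d dA sym.
set g := g11 * x ^+ 2 + 2 * g12 * x * y + g22 * y ^+ 2.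
have g_ge0 : 0 <= g.
  rewrite -(pmulr_rge0 _ g0); apply: le_trans (quadratic_form_ge _ _ _ _ _).
  by rewrite mulr_ge0 ?sqr_ge0 // ltW.
set I := (X in _ <= _ * X); set Re := (X in X <= _).
(* The last summand has the asymmetry of [G A] as a factor and vanishes; the rest is the
   Cayley-Hamilton identity. *)
have -> : Re = (a + d) / 2 * I - (a * d - b * c + 1) * g
  + (g12 * a + g22 * c - (g11 * b + g12 * d)) *
    (x * (c * x + d * y) - y * (a * x + b * y)) by rewrite /I /Re /g; field.
rewrite sym subrr mul0r addr0 gerBl mulr_ge0 //; lra.
Qed.

End QuadraticForm.

(** * Kallin's argument for the planes *)

Section KallinPlanes.
Variable R : realType.
Local Notation C2 := 'cV[R[i]^o]_2.

Lemma R2_scale (s : R) (z : C2) : R2 R z -> R2 R (s%:C *: z).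
Proof.
move=> /R2P[h0 h1]; apply/R2P; rewrite !mxE.
by move: h0 h1; case: (z 0 0) => a b /= ->; case: (z 1 0) => u v /= ->; split; ring.
Qed.

Lemma plane_of_scale A (s : R) (z : C2) : plane_of A z -> plane_of A (s%:C *: z).
Proof.
move=> [w Rw <-]; exists (s%:C *: w); first exact: R2_scale.
by rewrite -scalemxAr.
Qed.

(** Truncations at different radii of a set stable under real dilations are dilates of each other.
    The radii given for different pairs of planes need not agree. *)
Lemma compact_cone_ball (E : set C2) (r1 r : R) : 0 < r1 -> 0 < r ->
  (forall (s : R) z, E z -> E (s%:C *: z)) ->
  compact (E `&` closure (euclidean_ball 0 r1)) ->
  compact (E `&` closure (euclidean_ball 0 r)).
Proof.
move=> r10 r0 sE cE.
have s0 : 0 < r / r1 by rewrite divr_gt0.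
suff -> : E `&` closure (euclidean_ball 0 r) =
    ( *:%R (r / r1)%:C : C2 -> C2) @` (E `&` closure (euclidean_ball 0 r1)).
  apply: continuous_compact => //; apply: continuous_subspaceT.
  exact: scaler_continuous.
rewrite !closure_euclidean_ball //; apply/seteqP; split=> z /=.
  move=> [Ez zr]; exists ((r1 / r)%:C *: z).
    split; first exact: sE.
    rewrite euclidean_normZ mdl_real gtr0_norm ?divr_gt0 //.
    by rewrite mulrAC ler_pdivrMr // ler_pM2l.
  rewrite scalerA -rmorphM /=.
  have -> : r / r1 * (r1 / r) = 1 by field; rewrite !gt_eqF.
  by rewrite scale1r.
move=> [w [Ew wr] <-]; split; first exact: sE.
by rewrite euclidean_normZ mdl_real gtr0_norm // mulrAC ler_pdivrMr // ler_pM2l.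
Qed.

(** Polynomial convexity of the real disc: a quadratic polynomial excludes nonreal points, and the
    linear form [<z, x>] excludes real points outside the disc by Cauchy-Schwarz. *)
Lemma hull_real_ball (r : R) (z : C2) : 0 < r ->
  (forall f (B : R), polyfun f -> 0 <= B ->
     (forall x, R2 R x -> euclidean_norm x <= r -> mdl (f x) <= B) ->
     mdl (f z) <= B) ->
  R2 R z /\ euclidean_norm z <= r.
Proof.
move=> r0 h.
have imz j : complex.Im (z j 0) = 0.
  case zj : (z j 0) => [a b] /=; apply/eqP; apply: contraT => b0.
  (* Chosen so that [e * (u - a)^2 <= 1] for real [|u| <= r]: then [f] has values in [[0, 1]] on the
     disc but equals [1 + e * b^2] at [z]. *)
  pose e : R := ((r + `|a|) ^+ 2 + 1)^-1.
  have d0 : 0 < (r + `|a|) ^+ 2 + 1 by rewrite ltr_wpDl // sqr_ge0.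
  have e0 : 0 < e by rewrite invr_gt0.
  have b2 : 0 < e * b ^+ 2 by rewrite mulr_gt0 // lt_def sqrf_eq0 b0 sqr_ge0.
  pose f (x : C2) := 1 + - e%:C * ((x j 0 + - a%:C) * (x j 0 + - a%:C)).
  have : mdl (f z) <= 1.
    apply: h => //.
      apply: polyfunD; first exact: polyfun_cst.
      apply: polyfunM; first exact: polyfun_cst.
      by apply: polyfunM; (apply: polyfunD; [exact: polyfun_coord|exact: polyfun_cst]).
    move=> x /R2P[x0 x1] xr; have xj : complex.Im (x j 0) = 0.
      by case: (j) => [[|[|m]] hm] //; [rewrite -[RHS]x0|rewrite -[RHS]x1];
        congr (complex.Im (x _ _)); apply: val_inj.
    have := le_trans (Re_le_mdl (x j 0)) (le_trans (mdl_le_euclidean x j) xr).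
    move: xj; rewrite /f; case: (x j 0) => u v.
    rewrite [complex.Im _]/= [complex.Re _]/= => -> ur.
    have -> : 1 + - e%:C * ((u%:C + - a%:C) * (u%:C + - a%:C)) =
      (1 - e * (u - a) ^+ 2)%:C.
      by apply/eqP; rewrite eq_complex /=; apply/andP; split; apply/eqP; ring.
    rewrite mdl_real ler_norml.
    have h1 : 0 <= e * (u - a) ^+ 2 by rewrite mulr_ge0 ?sqr_ge0 // ltW.
    have h2 : e * (u - a) ^+ 2 <= 1.
      rewrite mulrC ler_pdivrMr // mul1r ler_wpDr // -[_ ^+ 2]real_normK ?num_real //.
      apply: lerXn2r; rewrite ?nnegrE ?addr_ge0 ?(ltW r0) //.
      by apply: (le_trans (ler_normB _ _)); rewrite lerD2r.
    by apply/andP; split; lra.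
  have -> : f z = (1 + e * b ^+ 2)%:C.
    rewrite /f zj.
    by apply/eqP; rewrite eq_complex /=; apply/andP; split; apply/eqP; ring.
  by rewrite mdl_real ger0_norm; lra.
split; first by apply/R2P; split.
rewrite leNgt; apply/negP => zr; set s := euclidean_norm z in zr.
have s0 : 0 < s by apply: lt_trans zr.
have mdlr (x : R[i]) : complex.Im x = 0 -> mdl x ^+ 2 = complex.Re x ^+ 2.
  by rewrite mdl_sqr => ->; rewrite expr0n addr0.
have nE (x : C2) : R2 R x ->
    euclidean_norm x ^+ 2 = complex.Re (x 0 0) ^+ 2 + complex.Re (x 1 0) ^+ 2.
  move=> /R2P[x0 x1]; rewrite euclidean_norm2 sqr_sqrtr ?addr_ge0 ?sqr_ge0 //.
  by rewrite !mdlr.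
have Rz : R2 R z by apply/R2P.
pose a := complex.Re (z 0 0); pose b := complex.Re (z 1 0).
have sE : s ^+ 2 = a ^+ 2 + b ^+ 2 by exact: nE.
have vE (x : C2) : R2 R x -> a%:C * x 0 0 + b%:C * x 1 0 =
    (a * complex.Re (x 0 0) + b * complex.Re (x 1 0))%:C.
  move=> /R2P[]; case: (x 0 0) => u u' /= ->; case: (x 1 0) => v v' /= ->.
  by apply/eqP; rewrite eq_complex /=; apply/andP; split; apply/eqP; ring.
suff H : s ^+ 2 <= s * r by move: H; rewrite expr2 ler_pM2l // leNgt zr.
have := h (fun x => a%:C * x 0 0 + b%:C * x 1 0) (s * r).
rewrite vE // -!expr2 -sE mdl_real ger0_norm ?sqr_ge0 //; apply.
- apply: polyfunD; apply: polyfunM; by [exact: polyfun_cst|exact: polyfun_coord].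
- by rewrite mulr_ge0 ?ltW.
move=> x Rx xr; rewrite vE // mdl_real.
have sr : 0 <= s * r by rewrite mulr_ge0 ?ltW.
rewrite -(@ler_pXn2r _ 2) ?nnegrE // real_normK ?num_real // exprMn.
apply: (@le_trans _ _ (s ^+ 2 * euclidean_norm x ^+ 2)); last first.
  apply: ler_wpM2l; first exact: sqr_ge0.
  by apply: lerXn2r; rewrite ?nnegrE ?sqrtr_ge0 ?(ltW r0).
rewrite sE nE //; move: (complex.Re (x 0 0)) (complex.Re (x 1 0)) => u v.
have := sqr_ge0 (a * v - b * u).
have -> : (a ^+ 2 + b ^+ 2) * (u ^+ 2 + v ^+ 2) =
  (a * u + b * v) ^+ 2 + (a * v - b * u) ^+ 2 by ring.
by move=> ?; rewrite lerDl.
Qed.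

(** If [p z] is nonzero, [z] lies in the hull of one of the two pieces. If [p z = 0], real points
    with small [p] are close to [0], which lies in [P]; bounds on [K2] then almost hold at them, and
    [z] lies in the hull of [K2]. *)
Lemma kallin_totally_real (P : set C2) (g11 g12 g22 c r : R) :
  0 < g11 -> 0 < g11 * g22 - g12 ^+ 2 -> 0 <= c -> 0 < r -> P 0 ->
  (forall z, P z -> complex.Re (qform g11 g12 g22 z) <=
                    c * `|complex.Im (qform g11 g12 g22 z)|) ->
  polynomially_convex (P `&` closure (euclidean_ball 0 r)) ->
  polynomial_hull ((R2 R `|` P) `&` closure (euclidean_ball 0 r)) =
  (R2 R `|` P) `&` closure (euclidean_ball 0 r).
Proof.
move=> g0 D0 c0 r0 P0 hP [_]; rewrite !closure_euclidean_ball //.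
set bll := [set z : C2 | _]; set K2 := P `&` bll => hK2.
pose K1 := R2 R `&` bll; set X := (_ `|` _) `&` _.
set p := qform g11 g12 g22 in hP.
have norm0 : euclidean_norm (0 : C2) <= r.
  rewrite -(scale0r (0 : C2)) euclidean_normZ Normc.normc0 mul0r; exact: ltW.
have R20 : R2 R 0 by apply/R2P; rewrite !mxE.
have K20 : K2 0 by [].
have X0 : X !=set0 by exists 0; split; [left|].
have Xr x : X x -> euclidean_norm x <= r by case.
have K2r x : K2 x -> euclidean_norm x <= r by case.
have g220 : 0 < g22.
  by rewrite -(pmulr_rgt0 _ g0); apply: le_lt_trans (sqr_ge0 g12) _; rewrite -subr_gt0.
have pR x : R2 R x -> exists u v : R, [/\ x 0 0 = u%:C, x 1 0 = v%:C &
    p x = (g11 * u ^+ 2 + 2 * g12 * u * v + g22 * v ^+ 2)%:C].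
  move=> /R2P[]; rewrite /p /qform; case: (x 0 0) => u u'; case: (x 1 0) => v v'.
  rewrite ![complex.Im _]/= => -> ->; exists u, v; split => //.
  by apply/eqP; rewrite eq_complex /=; apply/andP; split; apply/eqP; ring.
have qv u v : (g11 * g22 - g12 ^+ 2) * v ^+ 2 <=
    g11 * (g11 * u ^+ 2 + 2 * g12 * u * v + g22 * v ^+ 2).
  exact: quadratic_form_ge.
have qu u v : (g11 * g22 - g12 ^+ 2) * u ^+ 2 <=
    g22 * (g11 * u ^+ 2 + 2 * g12 * u * v + g22 * v ^+ 2).
  have := quadratic_form_ge g22 g12 g11 v u; rewrite [g22 * g11]mulrC.
  by congr (_ <= g22 * _); ring.
have g_ge0 u v : 0 <= g11 * u ^+ 2 + 2 * g12 * u * v + g22 * v ^+ 2.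
  rewrite -(pmulr_rge0 _ g0); apply: le_trans (qv u v).
  by rewrite mulr_ge0 ?sqr_ge0 // ltW.
apply/seteqP; split=> z; last first.
  by move=> Xz; apply: (polynomial_hullP X0 Xr) => f B _ _; apply.
move=> hz; have hull f B : polyfun f -> (forall x, X x -> mdl (f x) <= B) ->
    mdl (f z) <= B.
  by move=> Pf; exact: (polynomial_hull_le X0 Xr hz Pf).
have bounded f : polyfun f -> exists B : R, forall x, X x -> mdl (f x) <= B.
  move=> [q fq]; have [B hB] := poly_eval_bounded q r; exists B => x /Xr xr.
  by rewrite fq hB.
have Pp : polyfun p by exact: polyfun_qform.
have X12 x : X x -> K1 x \/ K2 x by move=> [[Rx|Px] xr]; [left|right].
have K1X : K1 `<=` X by move=> x [Rx xr]; split; [left|].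
have K2X : K2 `<=` X by move=> x [Px xr]; split; [right|].
have pK1 x : K1 x -> complex.Im (p x) = 0 /\ 0 <= complex.Re (p x).
  by move=> [/pR[u [v [_ _ ->]]] _]; split => //=.
have pK2 x : K2 x -> complex.Re (p x) <= c * `|complex.Im (p x)|.
  by move=> [Px _]; exact: hP.
have hullK2 : (forall f (B : R), polyfun f -> 0 <= B ->
    (forall x, K2 x -> mdl (f x) <= B) -> mdl (f z) <= B) -> X z.
  move=> h; apply: K2X; rewrite -hK2.
  by apply: (polynomial_hullP _ K2r h); exists 0.
have [pz|pz] := eqVneq (p z) 0; last first.
  have [h|] := kallin_off (@polyfun_cst R 2) (@polyfunD R 2) (@polyfunM R 2)
    bounded hull Pp c0 X12 K1X K2X pK1 pK2 pz; last exact: hullK2.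
  apply: K1X; apply: (hull_real_ball r0) => f B Pf B0 fB.
  by apply: h => // x [Rx xr]; exact: fB.
apply: hullK2 => f B Pf B0 fB; apply/ler_addgt0Pr => e e0.
have [C [C0 hC]] : lipschitz0 r f.
  case: Pf => q /funext ->; apply: lipschitz0_poly_eval; exact: ltW.
pose d := Num.min r (e / (C + 1)).
have C1 : 0 < C + 1 by rewrite ltr_wpDl.
have d0 : 0 < d by rewrite lt_min r0 divr_gt0.
have dr : d <= r by rewrite ge_min lexx.
have Cd : C * d <= e.
  apply: le_trans (_ : (C + 1) * d <= _).
    by rewrite ler_pM2r // lerDl.
  by rewrite mulrC -ler_pdivlMr // ge_min lexx orbT.
have gg : 0 < g11 + g22 by rewrite addr_gt0.
(* By definiteness, [|p x| <= t] on the real plane forces both coordinates of [x] to be at most [d]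
   in modulus. *)
pose t := (g11 * g22 - g12 ^+ 2) * d ^+ 2 / (g11 + g22).
have t0 : 0 < t by rewrite divr_gt0 // mulr_gt0 // exprn_gt0.
have Be : 0 <= B + e by rewrite addr_ge0 // ltW.
apply: (kallin_zero (@polyfun_cst R 2) (@polyfunD R 2) (@polyfunM R 2)
  bounded hull Pp c0 X12 pK1 pK2 pz Pf Be t0) => x Xx px.
case: (X12 x Xx) => [[Rx _]|K2x]; last first.
  by apply: le_trans (fB _ K2x) _; rewrite lerDl ltW.
have [u [v [xu xv pE]]] := pR _ Rx.
move: px; rewrite pE mdl_real ger0_norm //.
rewrite /t ler_pdivlMr // => px.
have small w : (g11 * g22 - g12 ^+ 2) * w ^+ 2 <=
    (g11 * u ^+ 2 + 2 * g12 * u * v + g22 * v ^+ 2) * (g11 + g22) -> `|w| <= d.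
  move=> hw; rewrite -(@ler_pXn2r _ 2) ?nnegrE ?(ltW d0) // real_normK ?num_real //.
  by rewrite -(ler_pM2l D0); apply: le_trans hw px.
have gu := mulr_ge0 (ltW g0) (g_ge0 u v); have gv := mulr_ge0 (ltW g220) (g_ge0 u v).
have xd j : mdl (x j 0) <= d.
  have [->|->] : j = 0 \/ j = 1.
    by case: j => [[|[|m]] hm] //; [left|right]; apply: val_inj.
    by rewrite xu mdl_real; apply: small; have := qu u v; lra.
  by rewrite xv mdl_real; apply: small; have := qv u v; lra.
have [_ fx] := hC x d (ltW d0) dr xd.
have -> : f x = f 0 + (f x - f 0) by ring.
apply: (le_trans (mdlD _ _)); apply: lerD; first exact: fB.
exact: le_trans fx Cd.
Qed.

End KallinPlanes.

(* Local polynomial convexity of the three planes *)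
Local Close Scope complex_scope.

Theorem theorem3p2 (R : realType) (A1 A2 : 'M[R]_2)
    (P0 P1 P2 : set 'cV[R[i]^o]_2)
    (hP0 : P0 = R2 R) (hP1 : P1 = plane_of A1) (hP2 : P2 = plane_of A2)
    (tr0 : totally_real_plane P0)
    (tr1 : totally_real_plane P1)
    (tr2 : totally_real_plane P2)
    (pc01 : locally_polynomially_convex (P0 `|` P1) 0)
    (pc02 : locally_polynomially_convex (P0 `|` P2) 0)
    (pc12 : locally_polynomially_convex (P1 `|` P2) 0)
    (det1 : `|\det A1| <= 1 /\ \det A1 < 0)
    (det2 : `|\det A2| <= 1 /\ \det A2 < 0)
    (hcomm : 0 < \det (A1 *m A2 - A2 *m A1)) :
  locally_polynomially_convex (P0 `|` P1 `|` P2) 0.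
Proof.
have UE : P0 `|` P1 `|` P2 = (P0 `|` P1) `|` (P1 `|` P2).
  by rewrite setUA -(setUA P0 P1 P1) setUid.
case: pc01 => cl01 z01 [s s0 [cs _]]; case: pc12 => cl12 z12 [r r0 pcr].
split; first by rewrite UE; exact: closedU.
  by left.
(* The radius comes from the pair [P1], [P2], whose truncated union has to be polynomially convex;
   compactness for [P0] and [P1] at this radius comes from rescaling. *)
exists r => //; split.
  rewrite UE setIUl; apply: compactU; last exact: pcr.1.
  apply: compact_cone_ball s0 r0 _ cs => t z.
  rewrite hP0 hP1 => -[Rz|Pz]; [left; exact: R2_scale|right; exact: plane_of_scale].
have [g11 [g12 [g22 [g0 D0 sym1 sym2]]]] := common_symmetrizer hcomm.
rewrite -setUA {1 2}hP0.
(* This slope is at least half of either trace in absolute value, so one sector serves both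
   planes. *)
have c0 : 0 <= (`|\tr A1| + `|\tr A2|) / 2 by rewrite divr_ge0 // addr_ge0.
apply: (kallin_totally_real g0 D0 c0 r0 z12 _ pcr).
move=> z Pz; set I := complex.Im _.
have le A : plane_of A z -> g11 * A 0 1 + g12 * A 1 1 = g12 * A 0 0 + g22 * A 1 0 ->
    `|\det A| <= 1 -> complex.Re (qform g11 g12 g22 z) <= `|\tr A| / 2 * `|I|.
  move=> PA symA /ler_normlP[dA _].
  apply: le_trans (qform_plane g0 D0 symA _ PA) _; first by lra.
  apply: (le_trans (ler_norm _)); rewrite !normrM -/I [`|2^-1|]ger0_norm //.
have I0 : 0 <= `|I| by [].
have h1 : 0 <= `|\tr A1| * `|I| by rewrite mulr_ge0.
have h2 : 0 <= `|\tr A2| * `|I| by rewrite mulr_ge0.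
case: Pz; rewrite ?hP1 ?hP2 => PA.
  by have := le A1 PA sym1 det1.1; lra.
by have := le A2 PA sym2 det2.1; lra.
Qed.
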